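(* Let $(H,\star)$ be a group, $K$ a nonempty set and $\theta:K\to H$ a map. Define four products on $H\times K$ by, for all $(\alpha,\alpha'),(\beta,\beta')\in H\times K$: $$(\alpha,\alpha')\leftarrow(\beta,\beta')=(\alpha,\alpha'),\quad(\alpha,\alpha')\rightarrow(\beta,\beta')=(\beta,\beta'),$$ $$(\alpha,\alpha')\triangleleft(\beta,\beta')=(\alpha^{-1}\star\beta,\beta'),\quad(\alpha,\alpha')\triangleright(\beta,\beta')=(\theta(\beta')\star\beta^{-1}\star\alpha,\alpha').$$ This defines a nondegenerate extended diassociative semigroup (EDS), denoted $\mathbf{EDS}^*(H,\star,K,\theta)$. It is commutative if, and only if, for any $\alpha'\in K$, $\theta(\alpha')$ is the unit of $H$. Moreover, for all $(\alpha,\alpha'),(\beta,\beta')\in H\times K$: $$(\alpha,\alpha')\curvearrowleft(\beta,\beta')=(\alpha,\alpha'),\quad(\alpha,\alpha')\blacktriangleleft(\beta,\beta')=(\alpha\star\beta,\beta'),$$ $$(\alpha,\alpha')\curvearrowright(\beta,\beta')=(\beta,\beta'),\quad(\alpha,\alpha')\blacktriangleright(\beta,\beta')=(\beta\star\theta(\beta')^{-1}\star\alpha,\alpha').$$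
   Context: Extended diassociative semigroups. A diassociative semigroup is a set $\Omega$ with maps $\leftarrow,\rightarrow:\Omega\times\Omega\to\Omega$ such that for all $\alpha,\beta,\gamma\in\Omega$: $(\alpha\leftarrow\beta)\leftarrow\gamma=\alpha\leftarrow(\beta\leftarrow\gamma)=\alpha\leftarrow(\beta\rightarrow\gamma)$; $(\alpha\rightarrow\beta)\leftarrow\gamma=\alpha\rightarrow(\beta\leftarrow\gamma)$; $(\alpha\rightarrow\beta)\rightarrow\gamma=(\alpha\leftarrow\beta)\rightarrow\gamma=\alpha\rightarrow(\beta\rightarrow\gamma)$. An extended diassociative semigroup (EDS) is $(\Omega,\leftarrow,\rightarrow,\triangleleft,\triangleright)$ such that $(\Omega,\leftarrow,\rightarrow)$ is a diassociative semigroup and for all $\alpha,\beta,\gamma\in\Omega$: $\alpha\triangleright(\beta\leftarrow\gamma)=\alpha\triangleright\beta$; $(\alpha\rightarrow\beta)\triangleleft\gamma=\beta\triangleleft\gamma$; $(\alpha\triangleleft\beta)\leftarrow((\alpha\leftarrow\beta)\triangleleft\gamma)=\alpha\triangleleft(\beta\leftarrow\gamma)$; $(\alpha\triangleleft\beta)\triangleleft((\alpha\leftarrow\beta)\triangleleft\gamma)=\beta\triangleleft\gamma$; $(\alpha\triangleleft\beta)\rightarrow((\alpha\leftarrow\beta)\triangleleft\gamma)=\alpha\triangleleft(\beta\rightarrow\gamma)$; $(\alpha\triangleleft\beta)\triangleright((\alpha\leftarrow\beta)\triangleleft\gamma)=\beta\triangleright\gamma$; $(\alpha\triangleright(\beta\rightarrow\gamma))\leftarrow(\beta\triangleright\gamma)=(\alpha\leftarrow\beta)\triangleright\gamma$;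 $(\alpha\triangleright(\beta\rightarrow\gamma))\triangleleft(\beta\triangleright\gamma)=\alpha\triangleleft\beta$; $(\alpha\triangleright(\beta\rightarrow\gamma))\rightarrow(\beta\triangleright\gamma)=(\alpha\rightarrow\beta)\triangleright\gamma$; $(\alpha\triangleright(\beta\rightarrow\gamma))\triangleright(\beta\triangleright\gamma)=\alpha\triangleright\beta$. It is commutative if $\alpha\rightarrow\beta=\beta\leftarrow\alpha$ and $\alpha\triangleright\beta=\beta\triangleleft\alpha$ for all $\alpha,\beta$. It is nondegenerate if the maps $\varphi_\leftarrow:(\alpha,\beta)\mapsto(\alpha\leftarrow\beta,\alpha\triangleleft\beta)$ and $\varphi_\rightarrow:(\alpha,\beta)\mapsto(\alpha\rightarrow\beta,\alpha\triangleright\beta)$ from $\Omega^2$ to $\Omega^2$ are bijective. For a nondegenerate EDS $\Omega$, the operations $\curvearrowleft,\blacktriangleleft,\curvearrowright,\blacktriangleright$ on $\Omega$ are defined by $\varphi_\leftarrow^{-1}(\alpha,\beta)=(\alpha\curvearrowleft\beta,\alpha\blacktriangleleft\beta)$ and $\varphi_\rightarrow^{-1}(\alpha,\beta)=(\beta\blacktriangleright\alpha,\beta\curvearrowright\alpha)$.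
   Formalization: In the last formula the second component is corrected from β' to α': (α,α')▶(β,β') = (β⋆θ(β')^{-1}⋆α, α'); the printed formula is false as soon as K has two elements. *)

(* Defs.v *)
From mathcomp Require Import all_boot.
From mathcomp Require Import boolp.

Set Implicit Arguments.
Unset Strict Implicit.
Unset Printing Implicit Defensive.

Record four_products (T : Type) := FourProducts {
  larrow : T -> T -> T;
  rarrow : T -> T -> T;
  ltri : T -> T -> T;
  rtri : T -> T -> T
}.

Section ExtendedDiassociativeSemigroups.

Variables (T : Type) (E : four_products T).

Local Notation "x ← y" := (larrow E x y) (at level 45, no associativity).
Local Notation "x → y" := (rarrow E x y) (at level 45, no associativity).
Local Notation "x ◁ y" := (ltri E x y) (at level 45, no associativity).
Local Notation "x ▷ y" := (rtri E x y) (at level 45, no associativity).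

Record is_diassociative : Prop := IsDiassociative {
  dias_ll_assoc : forall a b c, (a ← b) ← c = a ← (b ← c);
  dias_lr : forall a b c, a ← (b ← c) = a ← (b → c);
  dias_mid : forall a b c, (a → b) ← c = a → (b ← c);
  dias_rl : forall a b c, (a → b) → c = (a ← b) → c;
  dias_rr_assoc : forall a b c, (a ← b) → c = a → (b → c)
}.

Record is_EDS : Prop := IsEDS {
  EDS_diassociative : is_diassociative;
  EDS_rtri_larrow : forall a b c, a ▷ (b ← c) = a ▷ b;
  EDS_rarrow_ltri : forall a b c, (a → b) ◁ c = b ◁ c;
  EDS_ltri_larrow : forall a b c, (a ◁ b) ← ((a ← b) ◁ c) = a ◁ (b ← c);
  EDS_ltri_ltri : forall a b c, (a ◁ b) ◁ ((a ← b) ◁ c) = b ◁ c;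
  EDS_ltri_rarrow : forall a b c, (a ◁ b) → ((a ← b) ◁ c) = a ◁ (b → c);
  EDS_ltri_rtri : forall a b c, (a ◁ b) ▷ ((a ← b) ◁ c) = b ▷ c;
  EDS_rtri_larrow_rtri : forall a b c, (a ▷ (b → c)) ← (b ▷ c) = (a ← b) ▷ c;
  EDS_rtri_ltri_rtri : forall a b c, (a ▷ (b → c)) ◁ (b ▷ c) = a ◁ b;
  EDS_rtri_rarrow_rtri : forall a b c, (a ▷ (b → c)) → (b ▷ c) = (a → b) ▷ c;
  EDS_rtri_rtri : forall a b c, (a ▷ (b → c)) ▷ (b ▷ c) = a ▷ b
}.

Definition EDS_commutative : Prop :=
  (forall a b, a → b = b ← a) /\ (forall a b, a ▷ b = b ◁ a).

Definition phi_left (p : T * T) : T * T := (p.1 ← p.2, p.1 ◁ p.2).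

Definition phi_right (p : T * T) : T * T := (p.1 → p.2, p.1 ▷ p.2).

Definition EDS_nondegenerate : Prop :=
  bijective phi_left /\ bijective phi_right.

End ExtendedDiassociativeSemigroups.

Lemma bij_inv_exists (A B : Type) (f : A -> B) :
  bijective f -> exists2 g : B -> A, cancel f g & cancel g f.
Proof. by case=> g fK gK; exists g. Qed.

(* [bijective] lives in Prop, so its inverse is extracted by choice. *)
Definition bij_inv (A B : Type) (f : A -> B) (fbij : bijective f) : B -> A :=
  s2val (cid2 (bij_inv_exists fbij)).

Lemma bij_invK (A B : Type) (f : A -> B) (fbij : bijective f) :
  cancel f (bij_inv fbij).
Proof. exact: s2valP (cid2 (bij_inv_exists fbij)). Qed.

Lemma bij_invVK (A B : Type) (f : A -> B) (fbij : bijective f) :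
  cancel (bij_inv fbij) f.
Proof. exact: s2valP' (cid2 (bij_inv_exists fbij)). Qed.

(* Beware of the order of the arguments on the right-hand side:
   phi_left^-1 (a, b) = (curvearrowleft a b, blacktriangleleft a b), but
   phi_right^-1 (a, b) = (blacktriangleright b a, curvearrowright b a). *)
Section InverseProducts.

Variables (T : Type) (E : four_products T) (nd : EDS_nondegenerate E).

Definition curvearrowleft (a b : T) : T := (bij_inv nd.1 (a, b)).1.
Definition blacktriangleleft (a b : T) : T := (bij_inv nd.1 (a, b)).2.
Definition blacktriangleright (a b : T) : T := (bij_inv nd.2 (b, a)).1.
Definition curvearrowright (a b : T) : T := (bij_inv nd.2 (b, a)).2.

End InverseProducts.

Definition EDS_star (H : groupType) (K : Type) (theta : K -> H) :
    four_products (H * K) :=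
  {| larrow := fun a b => a;
     rarrow := fun a b => b;
     ltri := fun a b => (a.1^-1 * b.1, b.2)%g;
     rtri := fun a b => (theta b.2 * b.1^-1 * a.1, a.2)%g |}.

(* Main.v *)
Require Import Defs.
From mathcomp Require Import all_boot.

(** As [←] and [→] are projections, six of the ten mixed axioms hold by computation. The other four
    say that the difference x^-1 * y is unchanged when x and y are both left-multiplied by the same
    element ([invMM_cancel]). Nondegeneracy comes from solving a linear equation in [H] for each
    map, and these explicit inverses give the four derived products, since the inverse of a
    bijection is unique ([bij_invE]). *)

Lemma bij_invE (A B : Type) (f : A -> B) (fbij : bijective f) (g : B -> A) :
  cancel g f -> bij_inv fbij =1 g.
Proof. by move=> gK y; apply: (bij_inj fbij); rewrite bij_invVK gK. Qed.

Section EDSStar.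

Local Open Scope group_scope.

Variables (H : groupType) (K : Type) (theta : K -> H).

Local Notation E := (EDS_star theta).

Definition phi_left_inv (p : (H * K) * (H * K)) : (H * K) * (H * K) :=
  (p.1, (p.1.1 * p.2.1, p.2.2)).

(** [phi_right] sends (a, b) to (b, a ▷ b): the first component returns b, and then a is found by
    solving theta b' * b^-1 * x = y for x. *)
Definition phi_right_inv (p : (H * K) * (H * K)) : (H * K) * (H * K) :=
  ((p.1.1 * (theta p.1.2)^-1 * p.2.1, p.2.2), p.1).

Lemma phi_leftK : cancel (phi_left E) phi_left_inv.
Proof.
by move=> [[a a'] [b b']]; rewrite /phi_left /phi_left_inv /= mulVKg.
Qed.

Lemma phi_left_invK : cancel phi_left_inv (phi_left E).
Proof.
by move=> [[a a'] [b b']]; rewrite /phi_left /phi_left_inv /= mulKg.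
Qed.

Lemma phi_rightK : cancel (phi_right E) phi_right_inv.
Proof.
move=> [[a a'] [b b']]; rewrite /phi_right /phi_right_inv /=.
by rewrite -!mulgA mulKg mulVKg.
Qed.

Lemma phi_right_invK : cancel phi_right_inv (phi_right E).
Proof.
move=> [[a a'] [b b']]; rewrite /phi_right /phi_right_inv /=.
by rewrite -!mulgA mulKg mulVKg.
Qed.

Lemma EDS_star_nondegenerate : EDS_nondegenerate E.
Proof.
split; first exact: (Bijective phi_leftK phi_left_invK).
exact: (Bijective phi_rightK phi_right_invK).
Qed.

(** Left invariance of the difference: x will be a^-1 in the [◁] axioms and theta c' * c^-1 in the
    [▷] ones. *)
Lemma invMM_cancel (x y z : H) : (x * y)^-1 * (x * z) = y^-1 * z.
Proof. by rewrite invgM -mulgA mulKg. Qed.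

Lemma EDS_star_is_EDS : is_EDS E.
Proof.
split=> //= [a b c|a b c|a b c|a b c]; rewrite ?invMM_cancel //.
  (* The goals left are [EDS_ltri_rtri] and [EDS_rtri_rtri], where a leading [theta] factor must
     first be split off the difference. *)
  by rewrite -mulgA invMM_cancel mulgA.
by rewrite -(mulgA (theta _)) invMM_cancel mulgA.
Qed.

Lemma EDS_star_commutative : EDS_commutative E <-> (forall k, theta k = 1).
Proof.
split=> [[_ rtriC] k|theta1]; last first.
  by split=> // a b; rewrite /= theta1 mul1g.
(* At (1, k) both group elements vanish: [▷] yields [theta k] and [◁] yields 1. *)
by have [] := rtriC (1, k) (1, k); rewrite /= invg1 !mulg1.
Qed.

End EDSStar.

Theorem proposition9 (H : groupType) (K : Type) (K_nonempty : inhabited K)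
    (theta : K -> H) :
  [/\ is_EDS (EDS_star theta),
      EDS_nondegenerate (EDS_star theta),
      EDS_commutative (EDS_star theta) <-> (forall k : K, theta k = 1%g) &
      forall (nd : EDS_nondegenerate (EDS_star theta)) (a b : H * K),
        [/\ curvearrowleft nd a b = a,
            blacktriangleleft nd a b = (a.1 * b.1, b.2)%g,
            curvearrowright nd a b = b &
            blacktriangleright nd a b =
              (b.1 * (theta b.2)^-1 * a.1, a.2)%g]].
Proof.
split; [exact: EDS_star_is_EDS | exact: EDS_star_nondegenerate
       | exact: EDS_star_commutative |] => nd a b.
rewrite /curvearrowleft /blacktriangleleft /curvearrowright /blacktriangleright.
(* [nd] is an arbitrary proof, so its chosen inverses are opaque; uniqueness replaces them by the
   explicit ones. *)
rewrite (bij_invE _ _ _ _ _ (phi_left_invK H K theta)).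
by rewrite (bij_invE _ _ _ _ _ (phi_right_invK H K theta)).
Qed.
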